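(* Let $a\in\mathbb Q_3$ with $|a-1|_3\le1/3$, and define $\phi=\phi_{a,3}:\mathbb Q_3^2\to\mathbb Q_3^2$ by $\phi(x,y)=(a+3y-x^2,x)$. Then $J(\phi)$ is an attracting $2$-cycle.
   Context: $|\cdot|_3$ is the $3$-adic absolute value with $|3|_3=1/3$, and $\|(x,y)\|=\max(|x|_3,|y|_3)$. $J(\phi)$ is the set of $(x,y)\in\mathbb Q_3^2$ whose two-sided orbit $\{\phi^n(x,y):n\in\mathbb Z\}$ is bounded. For a homeomorphism $\phi$ of a metric space $(M,d)$, an attractor is a nonempty compact set $\mathcal A$ with $\phi(\mathcal A)=\mathcal A$ for which some open set $U$ properly containing $\mathcal A$ satisfies $\lim_{n\to+\infty}\min_{\alpha\in\mathcal A}d(\phi^n(\beta),\alpha)=0$ for all $\beta\in U$. An attracting $2$-cycle is an attractor of the form $\{P,\phi(P)\}$ with $\phi^2(P)=P\ne\phi(P)$. *)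

(* Defs.v *)
From HB Require Import structures.
From mathcomp Require Import all_boot all_order all_algebra.
From mathcomp Require Import ring_quotient ring.
From mathcomp Require Import all_classical all_reals.
From mathcomp Require Import topology normedtype sequences.
From mathcomp Require Import metric_structure.

Set Implicit Arguments.
Unset Strict Implicit.
Unset Printing Implicit Defensive.

Import Order.TTheory GRing.Theory Num.Theory.
Import numFieldNormedType.Exports.

Local Open Scope classical_set_scope.
Local Open Scope ring_scope.
Local Open Scope quotient_scope.

Definition padic_val (p : nat) (q : rat) : int :=
  (logn p `|numq q|)%:Z - (logn p `|denq q|)%:Z.

Definition padic_abs (R : realType) (p : nat) (q : rat) : R :=
  if q == 0 then 0 else p%:R ^ (- padic_val p q).

Section PadicAbs.
Context (R : realType) (p : nat) (p_pr : prime p).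
Implicit Types (q : rat) (m n : int).

Local Notation abs := (padic_abs R p).

Let p_gt0 : 0 < p%:R :> R.
Proof. by rewrite ltr0n prime_gt0. Qed.

Let p_gt1 : 1 < p%:R :> R.
Proof. by rewrite ltr1n prime_gt1. Qed.

Lemma padic_val_div m n : m != 0 -> n != 0 ->
  padic_val p (m%:Q / n%:Q) = (logn p `|m|)%:Z - (logn p `|n|)%:Z.
Proof.
move=> m0 n0; rewrite /padic_val; move: m0 n0.
case: divqP => [_ _|k x k0]; first by rewrite eqxx.
rewrite !mulf_eq0 !negb_or => /andP[_ x0] _.
rewrite !abszM !lognM ?absz_gt0 ?denq_neq0 //.
by rewrite !PoszD opprD addrACA subrr add0r.
Qed.

Lemma padic_abs0 : abs 0 = 0.
Proof. by rewrite /padic_abs eqxx. Qed.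

Lemma padic_abs_ge0 q : 0 <= abs q.
Proof. by rewrite /padic_abs; case: ifP => // _; rewrite exprz_ge0 ?ltW. Qed.

Lemma padic_abs_eq0 q : (abs q == 0) = (q == 0).
Proof.
rewrite /padic_abs; case: ifP => [_|_]; first by rewrite eqxx.
by apply/negbTE/expfz_neq0; rewrite gt_eqF.
Qed.

Lemma padic_abs1 : abs 1 = 1.
Proof.
rewrite /padic_abs oner_eq0 -[X in padic_val _ X](divq_num_den 1).
by rewrite padic_val_div ?denq_neq0 ?numq_eq0 // subrr oppr0 expr0z.
Qed.

Lemma padic_absM : {morph abs : x y / x * y}.
Proof.
move=> x y; rewrite /padic_abs mulf_eq0.
case: eqVneq => [_|x0]; first by rewrite mul0r.
case: eqVneq => [_|y0] /=; first by rewrite mulr0.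
rewrite -expfzDr ?gt_eqF // -opprD; congr (_ ^ (- _)).
rewrite -{1}(divq_num_den x) -{1}(divq_num_den y) mulf_div -!intrM.
rewrite padic_val_div ?mulf_neq0 ?numq_eq0 ?denq_neq0 //.
rewrite !abszM !lognM ?absz_gt0 ?numq_eq0 ?denq_neq0 // /padic_val.
by rewrite !PoszD opprD addrACA.
Qed.

Lemma padic_absN q : abs (- q) = abs q.
Proof. by rewrite /padic_abs oppr_eq0 /padic_val numqN denqN abszN. Qed.

Lemma padic_absB x y : abs (x - y) = abs (y - x).
Proof. by rewrite -padic_absN opprB. Qed.

Lemma padic_absV q : abs q^-1 = (abs q)^-1.
Proof.
have [->|q0] := eqVneq q 0; first by rewrite invr0 padic_abs0 invr0.
apply: (mulfI (x := abs q)); first by rewrite padic_abs_eq0.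
by rewrite -padic_absM divff ?padic_abs1 // divff // padic_abs_eq0.
Qed.

Lemma logn_abszD m n : m != 0 -> n != 0 -> m + n != 0 ->
  (minn (logn p (absz m)) (logn p (absz n)) <= logn p (absz (m + n)%R))%N.
Proof.
move=> m0 n0 mn0; set k := minn _ _.
rewrite -pfactor_dvdn ?absz_gt0 //.
suff : ((p ^ k)%N%:Z %| m + n)%Z by [].
by rewrite rpredD //; rewrite dvdzE /= pfactor_dvdn ?absz_gt0 // geq_min leqnn ?orbT.
Qed.

Lemma padic_absD x y : abs (x + y) <= Num.max (abs x) (abs y).
Proof.
have [->|x0] := eqVneq x 0; first by rewrite add0r le_max lexx orbT.
have [->|y0] := eqVneq y 0; first by rewrite addr0 le_max lexx.
have [xy0|xy0] := eqVneq (x + y) 0.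
  by rewrite xy0 padic_abs0 le_max padic_abs_ge0.
pose d := denq x * denq y; pose a := numq x * denq y; pose b := numq y * denq x.
have d0 : d != 0 by rewrite mulf_neq0.
have a0 : a != 0 by rewrite mulf_neq0 ?numq_eq0.
have b0 : b != 0 by rewrite mulf_neq0 ?numq_eq0.
have dx : (denq x)%:Q != 0 by rewrite intr_eq0.
have dy : (denq y)%:Q != 0 by rewrite intr_eq0.
have xE : x = a%:Q / d%:Q.
  by rewrite -{1}(divq_num_den x) /a /d !intrM -mulf_div divff ?mulr1.
have yE : y = b%:Q / d%:Q.
  rewrite -{1}(divq_num_den y) /b /d !intrM (mulrC (denq x)%:~R).
  by rewrite -mulf_div divff ?mulr1.
have xyE : x + y = (a + b)%:Q / d%:Q by rewrite {1}xE {1}yE -mulrDl -intrD.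
have ab0 : a + b != 0.
  by apply: contraNneq xy0 => ab0; rewrite xyE ab0 mul0r.
have ab_ge := logn_abszD a0 b0 ab0.
rewrite /padic_abs (negbTE x0) (negbTE y0) (negbTE xy0).
rewrite {1}xyE {1}xE {1}yE !padic_val_div // le_max !ler_eXz2l //.
rewrite !lerN2 !lerD2r !lez_nat -geq_min.
exact: ab_ge.
Qed.

End PadicAbs.

Section PadicCauchy.
Context (R : realType) (p : nat).
Implicit Types u v : nat -> rat.

Local Notation abs := (padic_abs R p).

(* The primality proof is unused in the body; it lets the subring structure,
   which needs it, be inferred from the predicate. *)
Definition padic_cauchy (_ : prime p) : {pred nat -> rat} := fun u =>
  `[< forall e : R, 0 < e -> exists N, forall m n : nat,
        (N <= m)%N -> (N <= n)%N -> abs (u m - u n) < e >].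

Variable p_pr : prime p.

Lemma padic_cauchyP u : reflect (forall e : R, 0 < e -> exists N,
  forall m n : nat, (N <= m)%N -> (N <= n)%N -> abs (u m - u n) < e)
  (u \in padic_cauchy p_pr).
Proof. exact: asboolP. Qed.

Lemma padic_cauchy_bounded u : u \in padic_cauchy p_pr ->
  exists2 M : R, 0 < M & forall n, abs (u n) <= M.
Proof.
move=> /padic_cauchyP /(_ 1 ltr01)[N uN].
pose M := \sum_(i < N.+1) abs (u i) + 1.
have S0 (n : nat) : 0 <= \sum_(i < n) abs (u i).
  by apply: sumr_ge0 => i _; apply: padic_abs_ge0.
exists M; first by rewrite ltr_wpDl ?S0.
have le_small (n : nat) : (n <= N)%N -> abs (u n) <= \sum_(i < N.+1) abs (u i).
  move=> nN; rewrite (bigD1 (inord n : 'I_N.+1)) //= inordK ?ltnS // lerDl.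
  by apply: sumr_ge0 => i _; apply: padic_abs_ge0.
move=> n; have [nN|/ltnW Nn] := leqP n N.
  by rewrite (le_trans (le_small _ nN)) // lerDl.
rewrite -[u n](subrK (u N)) (le_trans (padic_absD _ p_pr _ _)) // ge_max.
rewrite (le_trans (ltW (uN _ _ Nn (leqnn N)))) ?lerDr ?S0 //=.
by rewrite (le_trans (le_small _ (leqnn _))) // lerDl.
Qed.

Lemma padic_cauchy_subring : GRing.subring_closed (padic_cauchy p_pr).
Proof.
split.
- apply/padic_cauchyP => e e0; exists 0%N => m n _ _.
  by rewrite subrr padic_abs0.
- move=> u v /padic_cauchyP uC /padic_cauchyP vC.
  apply/padic_cauchyP => e e0.
  have [N uN] := uC e e0; have [N' vN] := vC e e0.
  exists (maxn N N') => m n; rewrite !geq_max => /andP[Nm N'm] /andP[Nn N'n].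
  have -> : (u - v) m - (u - v) n = (u m - u n) + (v n - v m).
    by rewrite -[(u - v) m]/(u m - v m) -[(u - v) n]/(u n - v n); ring.
  by rewrite (le_lt_trans (padic_absD _ p_pr _ _)) // gt_max uN ?vN.
- move=> u v uC vC.
  have [M M0 uM] := padic_cauchy_bounded uC.
  have [M' M'0 vM] := padic_cauchy_bounded vC.
  move: uC vC => /padic_cauchyP uC /padic_cauchyP vC.
  apply/padic_cauchyP => e e0.
  have [N uN] := uC (e / M') (divr_gt0 e0 M'0).
  have [N' vN] := vC (e / M) (divr_gt0 e0 M0).
  exists (maxn N N') => m n; rewrite !geq_max => /andP[Nm N'm] /andP[Nn N'n].
  have -> : (u * v) m - (u * v) n = (u m - u n) * v m + u n * (v m - v n).
    by rewrite -[(u * v) m]/(u m * v m) -[(u * v) n]/(u n * v n); ring.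
  rewrite (le_lt_trans (padic_absD _ p_pr _ _)) // !padic_absM // gt_max.
  apply/andP; split.
    rewrite (le_lt_trans (ler_wpM2l (padic_abs_ge0 _ p_pr _) (vM m))) //.
    by rewrite -ltr_pdivlMr // uN.
  rewrite (le_lt_trans (ler_wpM2r (padic_abs_ge0 _ p_pr _) (uM n))) //.
  by rewrite mulrC -ltr_pdivlMr // vN.
Qed.

HB.instance Definition _ :=
  GRing.isSubringClosed.Build _ (padic_cauchy p_pr) padic_cauchy_subring.

End PadicCauchy.

Section PadicSeq.
Context (R : realType) (p : nat) (p_pr : prime p).

Local Notation abs := (padic_abs R p).

Record padic_seq := PadicSeq {
  padic_seq_val :> nat -> rat;
  _ : padic_seq_val \in padic_cauchy R p_pr
}.

HB.instance Definition _ := [isSub for padic_seq_val].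
HB.instance Definition _ := [Choice of padic_seq by <:].
HB.instance Definition _ := [SubChoice_isSubComNzRing of padic_seq by <:].

Implicit Types u v : padic_seq.

Lemma padic_seqP u (e : R) : 0 < e -> exists N, forall m n : nat,
  (N <= m)%N -> (N <= n)%N -> abs (u m - u n) < e.
Proof. by case: u => u /= /padic_cauchyP; apply. Qed.

Definition padic_null : {pred padic_seq} := fun u =>
  `[< (abs (u n) @[n --> \oo] --> (0 : R)) >].

Lemma padic_nullP u : reflect (forall e : R, 0 < e -> exists N : nat,
  forall n, (N <= n)%N -> abs (u n) < e) (u \in padic_null).
Proof.
apply: (iffP (asboolP _)) => [/cvgrPdist_lt u0 e e0|u0].
  have [N _ Nu] := u0 e e0; exists N => n Nn.
  by have := Nu n Nn; rewrite /= sub0r normrN ger0_norm ?padic_abs_ge0.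
apply/cvgrPdist_lt => e e0; have [N Nu] := u0 e e0.
by exists N => // n /= Nn; rewrite sub0r normrN ger0_norm ?padic_abs_ge0 ?Nu.
Qed.

Lemma padic_null_ideal : idealr_closed padic_null.
Proof.
split.
- apply/padic_nullP => e e0; exists 0%N => n _.
  by rewrite -[(0 : padic_seq) n]/(0 : rat) padic_abs0.
- apply/padic_nullP => /(_ 1 ltr01)[N /(_ N (leqnn N))].
  by rewrite -[(1 : padic_seq) N]/(1 : rat) padic_abs1 // ltxx.
- move=> a u v /padic_nullP u0 /padic_nullP v0; apply/padic_nullP => e e0.
  have [M M0 aM] := padic_cauchy_bounded (valP a).
  have [N uN] := u0 (e / M) (divr_gt0 e0 M0); have [N' vN] := v0 e e0.
  exists (maxn N N') => n; rewrite geq_max => /andP[Nn N'n].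
  rewrite -[(a * u + v) n]/(a n * u n + v n).
  rewrite (le_lt_trans (padic_absD _ p_pr _ _)) // padic_absM // gt_max vN //.
  rewrite andbT (le_lt_trans (ler_wpM2r (padic_abs_ge0 _ p_pr _) (aM n))) //.
  by rewrite mulrC -ltr_pdivlMr // uN.
Qed.

HB.instance Definition _ := isIdealr.Build _ padic_null padic_null_ideal.

(* Q_p, as Cauchy sequences of rationals modulo null sequences. R is the field
   in which absolute values are taken. *)
Definition padic : Type := {ideal_quot padic_null}.

HB.instance Definition _ := GRing.ComNzRing.on padic.
HB.instance Definition _ := isPointed.Build padic 0.

Definition padic_pi (u : padic_seq) : padic := \pi_{ideal_quot padic_null} u.

Lemma padic_pi_repr (x : padic) : padic_pi (repr x) = x.
Proof. exact: reprK. Qed.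

Lemma padic_piB u v : padic_pi (u - v) = padic_pi u - padic_pi v.
Proof. exact: (rmorphB (\pi_{ideal_quot padic_null})). Qed.

Lemma padic_piD u v : padic_pi (u + v) = padic_pi u + padic_pi v.
Proof. exact: (rmorphD (\pi_{ideal_quot padic_null})). Qed.

Lemma padic_piN u : padic_pi (- u) = - padic_pi u.
Proof. exact: (rmorphN (\pi_{ideal_quot padic_null})). Qed.

Lemma padic_piM u v : padic_pi (u * v) = padic_pi u * padic_pi v.
Proof. exact: (rmorphM (\pi_{ideal_quot padic_null})). Qed.

Lemma padic_pi1 : padic_pi 1 = 1.
Proof. exact: (rmorph1 (\pi_{ideal_quot padic_null})). Qed.

Lemma padic_pi_eq u v : (padic_pi u == padic_pi v) = (u - v \in padic_null).
Proof. by rewrite Quotient.idealrBE. Qed.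

Lemma padic_pi_eq0 u : (padic_pi u == 0) = (u \in padic_null).
Proof.
have -> : 0 = padic_pi 0 by exact/esym/(rmorph0 (\pi_{ideal_quot padic_null})).
by rewrite padic_pi_eq subr0.
Qed.

Lemma padic_away0 u : u \notin padic_null ->
  exists2 e : R, 0 < e & exists N : nat, forall n, (N <= n)%N -> e <= abs (u n).
Proof.
move=> /padic_nullP/existsNP[e /not_implyP[e0 /forallNP uNull]].
exists e => //; have [N uN] := padic_seqP u e0; exists N => m Nm.
have /existsNP[n /not_implyP[Nn /negP]] := uNull N; rewrite -leNgt => eun.
rewrite leNgt; apply/negP => ume; move: eun; apply/negP; rewrite -ltNge.
rewrite -(subrK (u m) (u n)) (le_lt_trans (padic_absD _ p_pr _ _)) // gt_max.
by rewrite uN.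
Qed.

Lemma padic_has_inv (x : padic) : x != 0 -> exists y, y * x = 1.
Proof.
rewrite -[x]padic_pi_repr padic_pi_eq0; move: (repr x) => u {x}.
move=> /padic_away0[e e0 [N uN]].
have u_neq0 n : (N <= n)%N -> u n != 0.
  move=> Nn; rewrite -(padic_abs_eq0 R p_pr) gt_eqF //.
  by rewrite (lt_le_trans e0) ?uN.
pose v (n : nat) : rat := (u n)^-1.
have vC : v \in padic_cauchy R p_pr.
  apply/padic_cauchyP => d d0.
  have [N' uN'] := padic_seqP u (mulr_gt0 d0 (mulr_gt0 e0 e0)).
  exists (maxn N N') => m n; rewrite !geq_max => /andP[Nm N'm] /andP[Nn N'n].
  have -> : v m - v n = (u n - u m) * ((u m)^-1 * (u n)^-1).
    by rewrite /v; field; rewrite !u_neq0.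
  rewrite !padic_absM // !padic_absV // -invfM ltr_pdivrMr; last first.
    by rewrite mulr_gt0 // (lt_le_trans e0) ?uN.
  rewrite (lt_le_trans (uN' _ _ N'n N'm)) // ler_pM2l //.
  by rewrite ler_pM ?uN // ltW.
exists (padic_pi (PadicSeq vC)).
rewrite -padic_piM -padic_pi1; apply/eqP; rewrite padic_pi_eq.
apply/padic_nullP => d d0; exists N => n Nn.
rewrite -[(_ - 1 : padic_seq) n]/((u n)^-1 * u n - 1).
by rewrite mulVf ?u_neq0 // subrr padic_abs0.
Qed.

Definition padic_inv (x : padic) : padic := xget 0 [set y | y * x = 1].

Lemma padic_mulVf (x : padic) : x != 0 -> padic_inv x * x = 1.
Proof.
by move=> /padic_has_inv[y yx]; rewrite /padic_inv; case: xgetP => // /(_ y).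
Qed.

Lemma padic_inv0 : padic_inv 0 = 0.
Proof.
rewrite /padic_inv; case: xgetP => // y _ /eqP.
by rewrite mulr0 eq_sym oner_eq0.
Qed.

HB.instance Definition _ :=
  GRing.ComNzRing_isField.Build padic padic_mulVf padic_inv0.

Lemma padic_abs_dist (q r : rat) : `|abs q - abs r| <= abs (q - r).
Proof.
have le_ (a b : rat) : abs a - abs b <= abs (a - b).
  rewrite lerBlDr -{1}(subrK b a) (le_trans (padic_absD _ p_pr _ _)) //.
  by rewrite ge_max lerDl lerDr !padic_abs_ge0.
by rewrite ler_norml le_ andbT lerNl opprB padic_absB le_.
Qed.

Lemma padic_abs_cvg u : cvgn (fun n => abs (u n)).
Proof.
apply: cauchy_cvg; apply: cauchy_exP => e e0.
have [N uN] := padic_seqP u e0; exists (abs (u N)); exists N => // n /= Nn.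
by rewrite /ball /= (le_lt_trans (padic_abs_dist _ _)) // uN.
Qed.

(* The standard norm interface (normedZmodType) requires |x *+ n| = |x| *+ n,
   which fails for p-adic numbers; only the induced distance is an instance. *)
Definition padic_norm (x : padic) : R := limn (fun n => abs (repr x n)).

Lemma padic_norm_cvg u :
  abs (u n) @[n --> \oo] --> padic_norm (padic_pi u).
Proof.
set w := repr (padic_pi u).
have wu : u - w \in padic_null by rewrite -padic_pi_eq padic_pi_repr.
have wl : abs (w n) @[n --> \oo] --> padic_norm (padic_pi u).
  exact: padic_abs_cvg.
apply/cvgrPdist_lt => e e0.
have e20 : 0 < e / 2 by rewrite divr_gt0.
have [N uwN] := padic_nullP _ wu _ e20.
move/cvgrPdist_lt : wl => /(_ _ e20)[N' _ wN'].
exists (maxn N N') => // n /=; rewrite geq_max => /andP[Nn N'n].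
rewrite (le_lt_trans (ler_distD (abs (w n)) _ _)) // [ltRHS]splitr.
rewrite ltrD //; first exact: wN'.
by rewrite (le_lt_trans (padic_abs_dist _ _)) // padic_absB; exact: uwN.
Qed.

Arguments padic_norm_cvg : clear implicits.

Lemma padic_norm_eq u (l : R) :
  abs (u n) @[n --> \oo] --> l -> padic_norm (padic_pi u) = l.
Proof.
move=> ul; rewrite -(norm_cvg_lim ul); apply/esym/norm_cvg_lim.
exact: padic_norm_cvg.
Qed.

Lemma padic_norm_ge0 x : 0 <= padic_norm x.
Proof.
apply: limr_ge; first exact: padic_abs_cvg.
by exists 0%N => // n _; apply: padic_abs_ge0.
Qed.

Lemma padic_norm0 : padic_norm 0 = 0.
Proof.
have null0 : (0 : padic_seq) \in padic_null by rewrite rpred0.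
have <- : padic_pi 0 = 0 by apply/eqP; rewrite padic_pi_eq0.
by apply: padic_norm_eq; apply/asboolP.
Qed.

Lemma padic_norm0_eq0 x : padic_norm x = 0 -> x = 0.
Proof.
rewrite -[x]padic_pi_repr => x0; apply/eqP; rewrite padic_pi_eq0.
by apply/asboolP; rewrite -x0; exact: padic_norm_cvg.
Qed.

Lemma padic_normN x : padic_norm (- x) = padic_norm x.
Proof.
rewrite -[x]padic_pi_repr -padic_piN; apply: padic_norm_eq.
rewrite (_ : (fun n => _) = (fun n => abs (repr x n))).
  exact: padic_norm_cvg.
by apply/funext => n; rewrite -[(- repr x) n]/(- repr x n) padic_absN.
Qed.

Lemma padic_normB x y : padic_norm (x - y) = padic_norm (y - x).
Proof. by rewrite -padic_normN opprB. Qed.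

Lemma padic_normM : {morph padic_norm : x y / x * y}.
Proof.
move=> x y; rewrite -[x in LHS]padic_pi_repr -[y in LHS]padic_pi_repr -padic_piM.
apply: padic_norm_eq.
rewrite (_ : (fun n => _) = (fun n => abs (repr x n) * abs (repr y n))).
  by apply: cvgM; apply: padic_abs_cvg.
by apply/funext => n; rewrite -padic_absM.
Qed.

Lemma padic_normD x y : padic_norm (x + y) <= padic_norm x + padic_norm y.
Proof.
rewrite -[x in leLHS]padic_pi_repr -[y in leLHS]padic_pi_repr -padic_piD.
have xy_cvg : abs (repr x n) + abs (repr y n) @[n --> \oo] -->
    padic_norm x + padic_norm y.
  by apply: cvgD; apply: padic_abs_cvg.
apply: (ler_cvg_to (padic_norm_cvg (repr x + repr y)) xy_cvg).
near=> n.
rewrite (le_trans (padic_absD _ p_pr (repr x n) (repr y n))) //.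
by rewrite ge_max lerDl lerDr !padic_abs_ge0.
Unshelve. all: by end_near. Qed.

Definition padic_dist (x y : padic) : R := padic_norm (x - y).

Lemma padic_distxx x : padic_dist x x = 0.
Proof. by rewrite /padic_dist subrr padic_norm0. Qed.

Lemma padic_dist_eq0 x y : padic_dist x y = 0 -> x = y.
Proof. by move=> /padic_norm0_eq0/eqP; rewrite subr_eq0 => /eqP. Qed.

Lemma padic_distC x y : padic_dist x y = padic_dist y x.
Proof. exact: padic_normB. Qed.

Lemma padic_dist_triangle y x z :
  padic_dist x z <= padic_dist x y + padic_dist y z.
Proof. by rewrite /padic_dist (le_trans _ (padic_normD _ _)) // addrA subrK. Qed.

HB.instance Definition _ := isMetric.Build R padic
  padic_distxx padic_dist_eq0 padic_distC padic_dist_triangle.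

End PadicSeq.

Section ProdMetric.
Context (R : realType) (U V : metricType R).

Definition prod_mdist (x y : U * V) : R :=
  Num.max (mdist x.1 y.1) (mdist x.2 y.2).

Lemma prod_mdist_ge0 x y : 0 <= prod_mdist x y.
Proof. by rewrite le_max mdist_ge0. Qed.

Lemma prod_mdist_eq0 x y : prod_mdist x y = 0 -> x = y.
Proof.
move=> xy0; rewrite [x]surjective_pairing [y]surjective_pairing.
have : prod_mdist x y <= 0 by rewrite xy0.
by rewrite ge_max => /andP[x0 y0]; congr (_, _);
  apply: mdist_positivity; apply/eqP; rewrite eq_le mdist_ge0 andbT.
Qed.

Lemma prod_ballE (x : U * V) (e : R) : ball x e = [set y | prod_mdist x y < e].
Proof.
apply/seteqP; split => y /=; rewrite /prod_mdist gt_max.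
  by case; rewrite !ballEmdist /= => -> ->.
by move=> /andP[xy1 xy2]; split; rewrite ballEmdist.
Qed.

HB.instance Definition _ := PseudoMetric_isMetric.Build R (U * V)%type
  prod_mdist_ge0 prod_mdist_eq0 prod_ballE.

End ProdMetric.

Section PadicContinuity.
Context (R : realType) (p : nat) (p_pr : prime p).

Local Notation Qp := (padic R p_pr).

Import metricType_numDomainType.

Lemma padic_natr_neq0 (n : nat) : (0 < n)%N -> n%:R != 0 :> Qp.
Proof.
move=> n0; rewrite -(padic_pi1 R p_pr).
have -> : (padic_pi 1) *+ n = padic_pi (n%:R : padic_seq R p_pr).
  exact/esym/(rmorphMn (\pi_{ideal_quot (padic_null (p_pr := p_pr))})).
rewrite padic_pi_eq0; apply/negP => /asboolP.
have -> : (fun k => padic_abs R p ((n%:R : padic_seq R p_pr) k)) =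
    (fun=> padic_abs R p n%:R).
  apply/funext => k; congr padic_abs; elim: n {n0} => // n IHn.
  by rewrite -natr1 -[LHS]/((n%:R : padic_seq R p_pr) k + 1) IHn natr1.
move=> /(norm_cvg_lim) ; rewrite lim_cst // => /eqP.
by rewrite padic_abs_eq0 // pnatr_eq0 gtn_eqF.
Qed.

Context {T : Type} {F : set_system T} {FF : Filter F}.
Implicit Types (f g : T -> Qp) (x y : Qp).

Lemma padic_cvgP f x : f @ F --> x <->
  forall e : R, 0 < e -> \forall t \near F, padic_norm (x - f t) < e.
Proof. exact: cvgrPdist_lt. Qed.

Lemma padic_cvgD f g x y :
  f @ F --> x -> g @ F --> y -> (f t + g t) @[t --> F] --> x + y.
Proof.
move=> /padic_cvgP fx /padic_cvgP gy; apply/padic_cvgP => e e0.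
have e20 : 0 < e / 2 by rewrite divr_gt0.
near=> t; rewrite opprD addrACA (le_lt_trans (padic_normD _ _)) //.
rewrite [ltRHS]splitr ltrD //; near: t; [exact: fx|exact: gy].
Unshelve. all: by end_near. Qed.

Lemma padic_cvgN f x : f @ F --> x -> (- f t) @[t --> F] --> - x.
Proof.
move=> /padic_cvgP fx; apply/padic_cvgP => e e0.
near=> t; rewrite -opprD padic_normN; near: t; exact: fx.
Unshelve. all: by end_near. Qed.

Lemma padic_cvgM f g x y :
  f @ F --> x -> g @ F --> y -> (f t * g t) @[t --> F] --> x * y.
Proof.
move=> /padic_cvgP fx /padic_cvgP gy; apply/padic_cvgP => e e0.
pose M := padic_norm x + padic_norm y + 1.
have M0 : 0 < M by rewrite ltr_wpDl // addr_ge0 ?padic_norm_ge0.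
have eM0 : 0 < e / 2 / M by rewrite !divr_gt0.
near=> t.
have fxt : padic_norm (x - f t) < e / 2 / M by near: t; exact: fx.
have gyt : padic_norm (y - g t) < e / 2 / M by near: t; exact: gy.
have gy1 : padic_norm (y - g t) < 1 by near: t; exact: gy.
have -> : x * y - f t * g t = x * (y - g t) + (x - f t) * (y - (y - g t)).
  by rewrite subKr mulrBr mulrBl addrA subrK.
rewrite (le_lt_trans (padic_normD _ _)) // !padic_normM [ltRHS]splitr.
have xM : padic_norm x <= M by rewrite /M -addrA lerDl addr_ge0 ?padic_norm_ge0.
have yM : padic_norm (y - (y - g t)) <= M.
  rewrite (le_trans (padic_normD _ _)) // padic_normN /M.
  by apply: lerD; [rewrite lerDr padic_norm_ge0|exact: ltW].
have half (u v : R) : 0 <= u -> 0 <= v -> u <= M -> v < e / 2 / M ->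
    u * v < e / 2.
  move=> u0 v0 uM; rewrite ltr_pdivlMr // mulrC => vM.
  by rewrite (le_lt_trans (ler_wpM2r v0 uM)).
by apply: ltrD; [|rewrite mulrC]; apply: half; rewrite ?padic_norm_ge0.
Unshelve. all: by end_near. Qed.

End PadicContinuity.

Record homeomorphism (M : topologicalType) := Homeomorphism {
  homeo_fun :> M -> M;
  homeo_inv : M -> M;
  homeo_funK : cancel homeo_fun homeo_inv;
  homeo_invK : cancel homeo_inv homeo_fun;
  homeo_fun_continuous : continuous homeo_fun;
  homeo_inv_continuous : continuous homeo_inv
}.

Definition iterz (M : topologicalType) (phi : homeomorphism M) (n : int) :
    M -> M :=
  match n with
  | Posz k => iter k phi
  | Negz k => iter k.+1 (homeo_inv phi)
  end.

(* Since A is nonempty and compact, the infimum below is a minimum. *)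
Definition attractor (R : realType) (M : metricType R) (phi : homeomorphism M)
    (A : set M) : Prop :=
  [/\ A !=set0, compact A, phi @` A = A &
    exists U : set M, [/\ open U, A `<` U &
      forall b, U b ->
        inf [set mdist (iter n phi b) a | a in A] @[n --> \oo] --> (0 : R)]].

Definition attracting_2cycle (R : realType) (M : metricType R)
    (phi : homeomorphism M) (A : set M) : Prop :=
  attractor phi A /\
  exists P : M, [/\ A = [set P; phi P], phi (phi P) = P & P != phi P].

Section Henon.
Context (R : realType) (p : nat) (p_pr : prime p).

Local Notation Qp := (padic R p_pr).

Definition padic_norm2 (z : Qp * Qp) : R :=
  Num.max (padic_norm z.1) (padic_norm z.2).

Definition julia_set (phi : homeomorphism (Qp * Qp)%type) : set (Qp * Qp) :=
  [set z | exists C : R, forall n : int, padic_norm2 (iterz phi n z) <= C].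

Context (a b : Qp) (b_neq0 : b != 0).

Definition henon_fun (z : Qp * Qp) : Qp * Qp :=
  (a + b * z.2 - z.1 ^+ 2, z.1).

Definition henon_inv (z : Qp * Qp) : Qp * Qp :=
  (z.2, (z.1 - a + z.2 ^+ 2) / b).

Lemma henon_funK : cancel henon_fun henon_inv.
Proof.
case=> x y; rewrite /henon_fun /henon_inv /=; congr (_, _).
by rewrite addrAC subrK addrC addKr mulrC mulKf.
Qed.

Lemma henon_invK : cancel henon_inv henon_fun.
Proof.
case=> x y; rewrite /henon_fun /henon_inv /=; congr (_, _).
by rewrite mulrC divfK // addrA addrK addrC subrK.
Qed.

Lemma henon_fun_continuous : continuous henon_fun.
Proof.
move=> z.
have c1 : w.1 @[w --> z] --> z.1 by exact: cvg_fst.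
have c2 : w.2 @[w --> z] --> z.2 by exact: cvg_snd.
have c : (a + b * w.2 - w.1 ^+ 2) @[w --> z] --> a + b * z.2 - z.1 ^+ 2.
  apply: padic_cvgD; last by apply: padic_cvgN; apply: padic_cvgM.
  by apply: padic_cvgD; [|apply: padic_cvgM] => //; exact: cvg_cst.
exact: (cvg_pair c c1).
Qed.

Lemma henon_inv_continuous : continuous henon_inv.
Proof.
move=> z.
have c1 : w.1 @[w --> z] --> z.1 by exact: cvg_fst.
have c2 : w.2 @[w --> z] --> z.2 by exact: cvg_snd.
have c : ((w.1 - a + w.2 ^+ 2) / b) @[w --> z] --> (z.1 - a + z.2 ^+ 2) / b.
  apply: padic_cvgM; last exact: cvg_cst.
  apply: padic_cvgD; last exact: padic_cvgM.
  by apply: padic_cvgD => //; exact: cvg_cst.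
exact: (cvg_pair c2 c).
Qed.

Definition henon : homeomorphism (Qp * Qp)%type :=
  Homeomorphism henon_funK henon_invK henon_fun_continuous henon_inv_continuous.

End Henon.

Arguments padic_natr_neq0 {R p p_pr} n _.
Arguments henon {R p p_pr} a b b_neq0.

Notation Q3 R := (@padic R 3 isT).

(* Main.v *)
(* Modulo 3 the map is (x, y) |-> (1 - x^2, x), and 2 is not of the form
   1 - x^2, so phi^2 sends the unit polydisc into the two residue discs of
   (0, 1) and (1, 0), which phi exchanges. On the disc of (0, 1), phi^2 contracts
   distances by 1/3; since a - 3 = s^2 with s = 1 modulo 3, it contains the
   fixed point (s - 1, - s - 1) of phi^2, which yields an attracting 2-cycle.
   Conversely, if the coordinates of a bounded two-sided orbit had supremum
   S > 1, then x_n^2 = a + 3 x_(n-1) - x_(n+1) would give S^2 <= S; hence the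
   orbit lies in the unit polydisc, so in the two discs, and contracting from
   its distant past shows that it is the cycle. *)
Require Import Defs.
From mathcomp Require Import all_boot all_order all_algebra.
From mathcomp Require Import finfield ring_quotient ring lra zify.
From mathcomp Require Import all_classical all_reals.
From mathcomp Require Import topology normedtype sequences metric_structure.

Set Implicit Arguments.
Unset Strict Implicit.
Unset Printing Implicit Defensive.

Import Order.TTheory GRing.Theory Num.Theory.
Import numFieldNormedType.Exports.

Local Open Scope ring_scope.
Local Open Scope classical_set_scope.
Local Open Scope quotient_scope.

Lemma exists_expr_lt (R : realType) (r e : R) : 0 <= r -> r < 1 -> 0 < e ->
  exists k : nat, r ^+ k < e.
Proof.
move=> r0 r1 e0.
have /cvgrPdist_lt/(_ _ e0)[k _ /(_ k (leqnn k))] :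
    (r ^+ n) @[n --> \oo] --> 0 by apply: cvg_expr; rewrite ger0_norm.
by rewrite /= sub0r normrN ger0_norm ?exprn_ge0 //; exists k.
Qed.

(** * The absolute value on rationals and Fermat's little theorem *)

Section PadicAbs.
Context (R : realType) (p : nat) (p_pr : prime p).
Implicit Types (q x y : rat) (m n : int).

Local Notation abs := (padic_abs R p).

Lemma padic_absD_le x y (C : R) :
  abs x <= C -> abs y <= C -> abs (x + y) <= C.
Proof.
by move=> xC yC; rewrite (le_trans (padic_absD _ p_pr _ _)) // ge_max xC.
Qed.

(** Nonzero absolute values are integer powers of [p], so a strict bound by one power gives a weak
    bound by the preceding one. *)
Lemma padic_abs_discrete q (k : int) :
  abs q < p%:R ^ (k + 1) -> abs q <= p%:R ^ k.
Proof.
have p1 : 1 < p%:R :> R by rewrite ltr1n prime_gt1.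
rewrite /padic_abs; case: eqP => [_ _|_].
  by rewrite exprz_ge0 // ltW // (lt_trans ltr01).
by rewrite ltr_eXz2l // ler_eXz2l // => ?; lia.
Qed.

Lemma padic_abs_lt1 q : abs q < 1 -> abs q <= p%:R^-1.
Proof. by move=> q1; rewrite -exprN1 padic_abs_discrete. Qed.

Lemma padic_absX q (k : nat) : abs (q ^+ k) = abs q ^+ k.
Proof.
by elim: k => [|k IHk]; rewrite ?padic_abs1 // !exprS padic_absM ?IHk.
Qed.

Lemma padic_abs_int m : abs m%:Q <= 1 /\ (p %| m)%Z = (abs m%:Q <= p%:R^-1).
Proof.
have p1 : 1 < p%:R :> R by rewrite ltr1n prime_gt1.
have [->|m0] := eqVneq m 0.
  by rewrite padic_abs0 ler01 dvdz0 invr_ge0 (ltW (lt_trans ltr01 p1)).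
have -> : abs m%:Q = p%:R ^ (- (logn p `|m|)%:Z).
  rewrite /padic_abs intr_eq0 (negbTE m0) -[m%:Q]divr1 (_ : 1 = 1%:Q) //.
  by rewrite padic_val_div // logn1 subr0.
rewrite -exprN1 -[1](expr0z p%:R) !ler_eXz2l // dvdzE /= -[p in LHS]expn1.
by rewrite pfactor_dvdn ?absz_gt0 //; split; [|apply/idP/idP]; lia.
Qed.

Lemma padic_abs_nat (n : nat) : (0 < n < p)%N -> abs n%:R = 1.
Proof.
move=> /andP[n0 np]; have [n1 nE] := padic_abs_int n.
apply/eqP; rewrite eq_le n1 leNgt; apply/negP => /padic_abs_lt1.
by rewrite -nE dvdzE /= gtnNdvd.
Qed.

(** In lowest terms [q = a / b] with [p] dividing neither [a] nor [b], so by Fermat's little theorem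
    [p] divides [a ^+ p.-1 - b ^+ p.-1]. *)
Lemma padic_abs_fermat q : abs q = 1 -> abs (q ^+ p.-1 - 1) <= p%:R^-1.
Proof.
move=> q1; set a := numq q; set b := denq q.
have b0 : b%:Q != 0 by rewrite intr_eq0 denq_neq0.
have qE : q = a%:Q / b%:Q by rewrite divq_num_den.
have abE : abs a%:Q = abs b%:Q.
  by rewrite -[RHS]mul1r -q1 -padic_absM // {1}qE divfK.
have pb : ~~ (p %| b)%Z.
  apply/negP => pb; have pa : (p %| a)%Z.
    by rewrite (padic_abs_int a).2 abE -(padic_abs_int b).2.
  have := coprime_num_den q; rewrite /coprime => /eqP ab1.
  have : (p %| gcdn `|a| `|b|)%N by rewrite dvdn_gcd; apply/andP.
  by rewrite ab1 dvdn1 gtn_eqF // prime_gt1.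
have pa : ~~ (p %| a)%Z.
  by rewrite (padic_abs_int a).2 abE -(padic_abs_int b).2.
have b1 : abs b%:Q = 1.
  apply/eqP; rewrite eq_le (padic_abs_int b).1 leNgt.
  by apply: contra pb => /padic_abs_lt1; rewrite -(padic_abs_int b).2.
have little m : ~~ (p %| m)%Z -> m%:~R ^+ p.-1 = 1 :> 'F_p.
  rewrite (dvdz_pcharf (pchar_Fp p_pr)) => m0.
  apply: (mulfI m0); rewrite mulr1 -exprS prednK ?prime_gt0 //.
  by have := expf_card (m%:~R : 'F_p); rewrite card_Fp.
have -> : q ^+ p.-1 - 1 = (a ^+ p.-1 - b ^+ p.-1)%:Q / b%:Q ^+ p.-1.
  by rewrite intrB !rmorphXn /= mulrBl divff ?expf_neq0 // {1}qE expr_div_n.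
rewrite padic_absM // padic_absV // padic_absX b1 expr1n invr1 mulr1.
rewrite -(padic_abs_int _).2 (dvdz_pcharf (pchar_Fp p_pr)) rmorphB /=.
by rewrite !rmorphXn /= !little // subrr.
Qed.

End PadicAbs.

(** * The ultrametric norm and residues of p-adic numbers *)

Section PadicNorm.
Context (R : realType) (p : nat) (p_pr : prime p).

Local Notation abs := (padic_abs R p).
Local Notation Qp := (padic R p_pr).
Local Notation norm := (@padic_norm R p p_pr).
Implicit Types (x y : Qp) (u : padic_seq R p_pr).

Lemma padic_norm_le u (C : R) :
  (\forall n \near \oo, abs (u n) <= C) -> norm (padic_pi u) <= C.
Proof.
move=> uC; rewrite -(norm_cvg_lim (@padic_norm_cvg R p p_pr u)).
by apply: limr_le => //; apply/cvg_ex; eexists; exact: padic_norm_cvg.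
Qed.

Lemma near_padic_abs_lt u (C : R) :
  norm (padic_pi u) < C -> \forall n \near \oo, abs (u n) < C.
Proof. exact: (cvgr_lt _ (@padic_norm_cvg R p p_pr u)). Qed.

Lemma near_padic_abs_gt u (C : R) :
  C < norm (padic_pi u) -> \forall n \near \oo, C < abs (u n).
Proof. exact: (cvgr_gt _ (@padic_norm_cvg R p p_pr u)). Qed.

Lemma padic_norm_max x y : norm (x + y) <= Num.max (norm x) (norm y).
Proof.
(* The slack [e] makes the bounds strict, so that they pass to the late terms of the
   representatives. *)
apply/ler_addgt0Pr => e e0.
have maxe : Num.max (norm x) (norm y) < Num.max (norm x) (norm y) + e.
  by rewrite ltrDl.
move: maxe; set C := _ + e; rewrite gt_max => /andP[].
rewrite -[x]padic_pi_repr -[y]padic_pi_repr -padic_piD => xC yC.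
apply: padic_norm_le; near=> n.
rewrite (le_trans (padic_absD _ p_pr (repr x n) (repr y n))) // ge_max.
apply/andP; split; apply: ltW; near: n; exact: near_padic_abs_lt.
Unshelve. all: by end_near. Qed.

Lemma padic_normD_le x y (C : R) :
  norm x <= C -> norm y <= C -> norm (x + y) <= C.
Proof.
by move=> xC yC; rewrite (le_trans (padic_norm_max x y)) // ge_max xC.
Qed.

Lemma padic_normB_le x y (C : R) :
  norm x <= C -> norm y <= C -> norm (x - y) <= C.
Proof. by move=> xC yC; rewrite padic_normD_le // padic_normN. Qed.

Lemma padic_normM_le x y (C D : R) :
  norm x <= C -> norm y <= D -> norm (x * y) <= C * D.
Proof. by move=> xC yD; rewrite padic_normM ler_pM ?padic_norm_ge0. Qed.

Lemma padic_norm_cst u q : (forall n, u n = q) -> norm (padic_pi u) = abs q.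
Proof.
move=> uq; apply: padic_norm_eq.
rewrite (_ : (fun n => _) = (fun=> abs q)); first exact: cvg_cst.
by apply/funext => n; rewrite uq.
Qed.

Lemma padic_norm_nat (n : nat) : norm n%:R = abs n%:R.
Proof.
have -> : n%:R = padic_pi n%:R :> Qp.
  rewrite -(padic_pi1 R p_pr); apply/esym.
  exact: (rmorphMn (\pi_{ideal_quot (padic_null (p_pr := p_pr))})).
apply: padic_norm_cst => k; elim: n => // n IHn.
by rewrite -natr1 -[LHS]/((n%:R : padic_seq R p_pr) k + 1) IHn natr1.
Qed.

Lemma padic_norm1 : norm 1 = 1.
Proof. by rewrite (padic_norm_nat 1) padic_abs1. Qed.

Lemma padic_norm_p : norm p%:R = p%:R^-1.
Proof.
have p0 : p%:R != 0 :> rat by rewrite pnatr_eq0 -lt0n prime_gt0.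
rewrite padic_norm_nat /padic_abs (negbTE p0) -exprN1; congr (_ ^ (- _)).
have -> : p%:R = p%:Z%:Q / 1%:Z%:Q :> rat by rewrite divr1.
rewrite padic_val_div //= ?logn1 ?subr0 ?logn_prime ?eqxx //.
by rewrite -lt0n prime_gt0.
Qed.

Lemma padic_norm_lt1 x : norm x < 1 -> norm x <= p%:R^-1.
Proof.
rewrite -[x]padic_pi_repr => x1; apply: padic_norm_le; near=> n.
by apply: padic_abs_lt1 => //; near: n; exact: near_padic_abs_lt.
Unshelve. all: by end_near. Qed.

(** Stands in for the residue field: with [p = 3], either [x] is 0 or [x ^+ 2] is 1 modulo 3. *)
Lemma padic_norm_fermat x : norm x <= 1 ->
  norm x <= p%:R^-1 \/ norm (x ^+ p.-1 - 1) <= p%:R^-1.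
Proof.
have p1 : 1 < p%:R :> R by rewrite ltr1n prime_gt1.
rewrite le_eqVlt => /predU1P[|]; last by left; exact: padic_norm_lt1.
rewrite -[x]padic_pi_repr; move: (repr x) => u x1; right.
have -> : padic_pi u ^+ p.-1 - 1 = padic_pi (u ^+ p.-1 - 1).
  rewrite padic_piB padic_pi1; congr (_ - _).
  exact/esym/(rmorphXn (\pi_{ideal_quot (padic_null (p_pr := p_pr))})).
apply: padic_norm_le; near=> n.
rewrite (_ : (u ^+ p.-1 - 1 : padic_seq _ _) n = u n ^+ p.-1 - 1); last first.
  rewrite -[LHS]/((u ^+ p.-1 : padic_seq _ _) n - 1); congr (_ - _).
  elim: p.-1 => // k IHk; rewrite exprS.
  by rewrite -[LHS]/(u n * (u ^+ k : padic_seq _ _) n) IHk -exprS.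
(* Eventually [abs (u n)] lies strictly between [p%:R^-1] and [p%:R], so it equals 1 by
   discreteness. *)
apply: padic_abs_fermat => //; apply/eqP; rewrite eq_le; apply/andP; split.
  rewrite -[leRHS](expr0z p%:R) padic_abs_discrete // add0r expr1z.
  by near: n; apply: near_padic_abs_lt; rewrite x1.
rewrite leNgt; apply/negP => /(padic_abs_lt1 p_pr); apply/negP.
rewrite -ltNge; near: n; apply: near_padic_abs_gt.
by rewrite x1 invf_lt1 // (lt_trans ltr01).
Unshelve. all: by end_near. Qed.

End PadicNorm.

(** * Square roots near 1, for odd p *)

Section PadicSqrt.
Context (R : realType) (p : nat) (p_pr : prime p).

Local Notation abs := (padic_abs R p).
Local Notation Qp := (padic R p_pr).
Local Notation norm := (@padic_norm R p p_pr).

Let p_ge0 : 0 <= p%:R^-1 :> R. Proof. by rewrite invr_ge0. Qed.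

Let p_lt1 : p%:R^-1 < 1 :> R.
Proof. by rewrite invf_lt1 ?ltr1n ?ltr0n ?prime_gt1 ?prime_gt0. Qed.

(* In an ultrametric space a sequence is Cauchy as soon as its consecutive
   terms get arbitrarily close. *)
Lemma padic_cauchy_succ (u : nat -> rat) :
  (forall k, exists N : nat, forall n, (N <= n)%N ->
     abs (u n.+1 - u n) <= p%:R^-1 ^+ k) ->
  u \in padic_cauchy R p_pr.
Proof.
move=> du; apply/padic_cauchyP => e e0.
have [k ke] := exists_expr_lt p_ge0 p_lt1 e0; have [N uN] := du k.
have uD n : abs (u (N + n)%N - u N) <= p%:R^-1 ^+ k.
  elim: n => [|n IHn]; first by rewrite addn0 subrr padic_abs0 exprn_ge0.
  rewrite -(subrK (u (N + n)%N) (u (N + n.+1)%N)) -addrA.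
  by rewrite padic_absD_le // addnS uN // leq_addr.
exists N => m n /subnKC <- /subnKC <-; apply: le_lt_trans ke.
rewrite -(subrK (u N) (u (N + (m - N))%N)) -addrA padic_absD_le //.
by rewrite padic_absB.
Qed.

Variables (c : nat -> rat) (p_odd : (2 < p)%N).
Hypothesis c1 : forall n, abs (c n - 1) <= p%:R^-1.

(* Solving s ^+ 2 = c by s |-> s - (s ^+ 2 - c) / 2, a contraction near 1,
   while c runs through rational approximations. *)
Fixpoint sqrt_iter (n : nat) : rat :=
  if n is k.+1 then sqrt_iter k - (sqrt_iter k ^+ 2 - c k) / 2 else 1.

Let abs2 x : abs (x / 2) = abs x.
Proof. by rewrite padic_absM // padic_absV // padic_abs_nat // invr1 mulr1. Qed.

(** The new error is a multiple of [(s - 1) ^+ 2] plus half of [c n - 1], and 2 is a unit since [p]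
    is odd. *)
Lemma sqrt_iter_near1 n : abs (sqrt_iter n - 1) <= p%:R^-1.
Proof.
elim: n => [|n IHn] /=; first by rewrite subrr padic_abs0.
set s := sqrt_iter n in IHn *.
have -> : s - (s ^+ 2 - c n) / 2 - 1
    = - ((s - 1) * (s - 1) / 2) + (c n - 1) / 2 by field.
rewrite padic_absD_le ?abs2 // padic_absN abs2 padic_absM //.
by rewrite -[leRHS]mulr1 ler_pM ?padic_abs_ge0 // (le_trans IHn) // ltW.
Qed.

(** The next increment is the last one times [- ((t - 1) + (s - 1)) / 2], which gains a factor
    [p%:R^-1], plus half an increment of [c], small because [c] eventually follows the Cauchy
    sequence [u]. *)
Lemma sqrt_iter_succ u : u \in padic_cauchy R p_pr ->
  (\forall n \near \oo, c n = u n) -> forall k, exists N : nat,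
    forall n, (N <= n)%N -> abs (sqrt_iter n.+1 - sqrt_iter n) <= p%:R^-1 ^+ k.
Proof.
move=> /padic_cauchyP uC [N0 _ cu]; elim=> [|k [N IHk]].
  exists 0%N => n _; rewrite -(subrK 1 (sqrt_iter n.+1)) -addrA.
  rewrite padic_absD_le //; first exact: le_trans (sqrt_iter_near1 _) (ltW p_lt1).
  by rewrite padic_absB; exact: le_trans (sqrt_iter_near1 _) (ltW p_lt1).
have k0 : 0 < p%:R^-1 ^+ k.+1 :> R.
  by rewrite exprn_gt0 // invr_gt0 ltr0n prime_gt0.
have [N1 uN] := uC _ k0.
(* The successor leaves room to apply the induction hypothesis one index earlier. *)
exists (maxn N0 (maxn N N1)).+1 => -[//|n].
rewrite ltnS !geq_max => /and3P[N0n Nn N1n].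
have := IHk n Nn; have := sqrt_iter_near1 n; have := sqrt_iter_near1 n.+1.
set t := sqrt_iter n.+1; set s := sqrt_iter n => t1 s1 ts.
rewrite [sqrt_iter n.+2](_ : _ = t - (t ^+ 2 - c n.+1) / 2) //.
have tE : t = s - (s ^+ 2 - c n) / 2 by [].
rewrite [X in _ - X]tE.
have -> : t - (t ^+ 2 - c n.+1) / 2 - (s - (s ^+ 2 - c n) / 2)
    = - ((t - 1 + (s - 1)) * (t - s) / 2) + (c n.+1 - c n) / 2.
  by clearbody t s; field.
rewrite padic_absD_le ?abs2 //; last first.
  by rewrite !cu ?ltW ?uN //= ltnW.
rewrite padic_absN abs2 padic_absM // exprS.
by rewrite ler_pM ?padic_abs_ge0 // padic_absD_le.
Qed.

End PadicSqrt.

Lemma padic_sqrt (R : realType) (p : nat) (p_pr : prime p) (c : padic R p_pr) :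
  (2 < p)%N -> padic_norm (c - 1) <= p%:R^-1 ->
  exists2 s : padic R p_pr, s ^+ 2 = c & padic_norm (s - 1) <= p%:R^-1.
Proof.
move=> p_odd; have p1 : p%:R^-1 < 1 :> R.
  by rewrite invf_lt1 ?ltr1n ?ltr0n ?prime_gt1 ?prime_gt0.
rewrite -[c]padic_pi_repr -(padic_pi1 R p_pr) -padic_piB; move: (repr c) => u c1.
have [N _ uN] := near_padic_abs_lt (le_lt_trans c1 p1).
(* The early terms are replaced by 1, since the iteration needs every term near 1; the class of [u]
   is unaffected. *)
pose d n := if (N <= n)%N then u n else 1.
have d1 n : padic_abs R p (d n - 1) <= p%:R^-1.
  rewrite /d; case: ifPn => [/uN|_]; first exact: padic_abs_lt1.
  by rewrite subrr padic_abs0 invr_ge0.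
have du : \forall n \near \oo, d n = u n by exists N => // n /= Nn; rewrite /d Nn.
have ds := sqrt_iter_succ p_odd d1 (valP u) du.
pose s : padic_seq R p_pr := PadicSeq (padic_cauchy_succ p_pr ds).
exists (padic_pi s); last first.
  rewrite -padic_piB; apply: padic_norm_le; apply: nearW => n.
  exact: sqrt_iter_near1.
rewrite expr2 -padic_piM; apply/eqP; rewrite padic_pi_eq.
apply/padic_nullP => e e0.
have p0 : 0 <= p%:R^-1 :> R by rewrite invr_ge0.
have [k ke] := exists_expr_lt p0 p1 e0.
have [M sM] := ds k; case: du => M' _ dM'.
exists (maxn M M') => n; rewrite geq_max => /andP[Mn M'n].
rewrite -[(_ - u) n]/(sqrt_iter d n * sqrt_iter d n - u n).
(* An increment of the iteration is minus half the defect [t * t - d n], so small increments mean a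
   small defect. *)
apply: le_lt_trans ke; rewrite (le_trans _ (sM n Mn)) //=.
set t := sqrt_iter d n.
have -> : t - (t ^+ 2 - d n) / 2 - t = - ((t * t - d n) / 2) by ring.
rewrite padic_absN padic_absM // padic_absV // padic_abs_nat //.
by rewrite invr1 mulr1 dM'.
Qed.

(** * Two-sided iterates and bounded families *)

Lemma iterzS (M : topologicalType) (phi : homeomorphism M) (n : int) (z : M) :
  iterz phi (n + 1) z = phi (iterz phi n z).
Proof.
case: n => [n|[|n]]; first by have -> : Posz n + 1 = Posz n.+1 by lia.
  by rewrite /= homeo_invK.
have -> : Negz n.+1 + 1 = Negz n by lia.
by rewrite [iterz _ (Negz n.+1) z]iterS homeo_invK.
Qed.

Lemma iterz_in (M : topologicalType) (phi : homeomorphism M) (S : set M) :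
  (forall z, S z -> S (phi z)) -> (forall z, S z -> S (homeo_inv phi z)) ->
  forall n z, S z -> S (iterz phi n z).
Proof.
move=> Sphi Sinv [] n z Sz; first by elim: n => //= n; exact: Sphi.
by rewrite /=; apply: (Sinv); elim: n => //= n; exact: Sinv.
Qed.

(** With [S] the supremum, some value exceeds [(1 + S) / 2], whose square is at least [S > 1]. *)
Lemma lt_sq_sup (R : realType) (T : Type) (f : T -> R) (C : R) (t0 : T) :
  (forall t, f t <= C) -> 1 < f t0 ->
  exists t, forall t', Num.max 1 (f t') < f t ^+ 2.
Proof.
move=> fC f1; set S := sup (range f).
have ubS : has_ubound (range f) by exists C => _ [t _ <-].
have fS t : f t <= S by apply: ub_le_sup => //; exists t.
have S1 : 1 < S := lt_le_trans f1 (fS t0).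
have supS : has_sup (range f) by split=> //; exists (f t0), t0.
have e0 : 0 < (S - 1) / 2 by rewrite divr_gt0 // subr_gt0.
have [_ [t _ <-] ft] := sup_adherent e0 supS.
have S_lt : S < f t ^+ 2.
  have : 1 + (S - 1) / 2 < f t by rewrite -/S in ft; lra.
  by rewrite expr2; nra.
by exists t => t'; rewrite gt_max (lt_trans S1 S_lt) (le_lt_trans (fS t')).
Qed.

Lemma padic_mdist_le (R : realType) (p : nat) (p_pr : prime p)
    (z w : padic R p_pr * padic R p_pr) (r : R) :
  (mdist z w <= r) =
  (padic_norm (z.1 - w.1) <= r) && (padic_norm (z.2 - w.2) <= r).
Proof. exact: ge_max. Qed.

(** * The map on the residue discs, and bounded orbits *)

Section Dynamics.
Context (R : realType) (a : Q3 R).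
Hypothesis a1 : padic_norm (a - 1) <= 3^-1.

Local Notation norm := (@padic_norm R 3 isT).
Local Notation f := (henon_fun a 3).
Implicit Types (x y : Q3 R) (z w : (Q3 R * Q3 R)%type).

Let third_le1 : 3^-1 <= 1 :> R. Proof. by rewrite invf_le1 ?ler1n. Qed.

Let norm3 : norm 3 = 3^-1. Proof. exact: padic_norm_p. Qed.

Let norm3M x : norm x <= 1 -> norm (3 * x) <= 3^-1.
Proof.
by move=> x1; rewrite -[leRHS]mulr1 padic_normM_le // norm3.
Qed.

Let norm_le1 x : norm x <= 3^-1 -> norm x <= 1.
Proof. by move/le_trans; apply. Qed.

Let norm_near1_le1 x : norm (x - 1) <= 3^-1 -> norm x <= 1.
Proof.
move=> x1; rewrite -(subrK 1 x) padic_normD_le ?padic_norm1 //.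
exact: norm_le1.
Qed.

Let a_le1 : norm a <= 1. Proof. exact: norm_near1_le1. Qed.

(* The residue discs of (0, 1) and (1, 0) modulo 3. *)
Definition disc01 : set (Q3 R * Q3 R) :=
  [set z | norm z.1 <= 3^-1 /\ norm (z.2 - 1) <= 3^-1].
Definition disc10 : set (Q3 R * Q3 R) :=
  [set z | norm (z.1 - 1) <= 3^-1 /\ norm z.2 <= 3^-1].

Lemma disc01_10 z : disc01 z -> disc10 z -> False.
Proof.
move=> [z1 _] [z1' _]; have : norm (z.1 - (z.1 - 1)) <= 3^-1.
  exact: padic_normB_le.
by rewrite subKr padic_norm1 leNgt invf_lt1 // ltr1n.
Qed.

Lemma henon_near1 z : norm z.1 <= 3^-1 -> norm z.2 <= 1 ->
  norm ((f z).1 - 1) <= 3^-1.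
Proof.
move=> z1 z2; rewrite /henon_fun /=.
have -> : a + 3 * z.2 - z.1 ^+ 2 - 1 = a - 1 + 3 * z.2 - z.1 * z.1 by ring.
apply: padic_normB_le; first by apply: padic_normD_le => //; exact: norm3M.
by rewrite -[leRHS]mulr1 padic_normM_le // norm_le1.
Qed.

Lemma henon_near0 z : norm (z.1 ^+ 2 - 1) <= 3^-1 -> norm z.2 <= 1 ->
  norm (f z).1 <= 3^-1.
Proof.
move=> z1 z2; rewrite /henon_fun /=.
have -> : a + 3 * z.2 - z.1 ^+ 2 = a - 1 + 3 * z.2 - (z.1 ^+ 2 - 1) by ring.
by apply: padic_normB_le => //; apply: padic_normD_le => //; exact: norm3M.
Qed.

Lemma henon_disc01 z : disc01 z -> disc10 (f z).
Proof.
by move=> [z1 z2]; split=> //; apply: henon_near1 => //; exact: norm_near1_le1.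
Qed.

Lemma henon_disc10 z : disc10 z -> disc01 (f z).
Proof.
move=> [z1 z2]; split=> //; apply: (henon_near0 _ (norm_le1 z2)).
have -> : z.1 ^+ 2 - 1 = (z.1 - 1) * (z.1 + 1) by ring.
rewrite -[leRHS]mulr1 padic_normM_le // padic_normD_le ?padic_norm1 //.
exact: norm_near1_le1.
Qed.

(* 2 is not of the form 1 - x^2 modulo 3. *)
Lemma henon2_disc z : norm z.1 <= 1 -> norm z.2 <= 1 ->
  disc01 (f (f z)) \/ disc10 (f (f z)).
Proof.
move=> z1 z2; case: (padic_norm_fermat z1) => /= [|] z1'.
  have fz := henon_near1 z1' z2; left; split=> //.
  apply: (@henon_near0 (f z) _ z1).
  have -> : (f z).1 ^+ 2 - 1 = ((f z).1 - 1) * ((f z).1 + 1) by ring.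
  rewrite -[leRHS]mulr1 padic_normM_le // padic_normD_le ?padic_norm1 //.
  exact: norm_near1_le1.
have fz := henon_near0 z1' z2; right; split=> //.
exact: henon_near1.
Qed.

(** Both terms of the difference gain a factor 1/3: one from the coefficient 3, the other from
    [z.1 + w.1], divisible by 3 on [disc01]. *)
Lemma henon_fst_contract z w (r : R) : disc01 z -> disc01 w ->
  mdist z w <= r -> norm ((f z).1 - (f w).1) <= r / 3.
Proof.
rewrite padic_mdist_le => -[z1 _] [w1 _] /andP[d1 d2].
have -> : (f z).1 - (f w).1 = (z.2 - w.2) * 3 - (z.1 - w.1) * (z.1 + w.1).
  by rewrite /henon_fun /=; ring.
apply: padic_normB_le; apply: padic_normM_le; rewrite ?norm3 //.
exact: padic_normD_le.
Qed.

Lemma henon_nonexpansive z w : disc01 z -> disc01 w ->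
  mdist (f z) (f w) <= mdist z w.
Proof.
move=> zA wA; have fd := henon_fst_contract zA wA (lexx _).
rewrite padic_mdist_le (le_trans fd) ?ler_piMr ?mdist_ge0 //=.
by have := lexx (mdist z w); rewrite {1}padic_mdist_le => /andP[].
Qed.

(** The second coordinate of [f (f z)] is the first one of [f z], already contracted. In the first
    coordinate, the coefficient 3 contracts one term, and the other carries that contracted
    difference. *)
Lemma henon2_contract z w (r : R) : disc01 z -> disc01 w -> mdist z w <= r ->
  mdist (f (f z)) (f (f w)) <= r / 3.
Proof.
move=> zA wA zw; have fd := henon_fst_contract zA wA zw.
have [[fz1 _] [fw1 _]] := (henon_disc01 zA, henon_disc01 wA).
move: zw; rewrite !padic_mdist_le => /andP[d1 _]; apply/andP; split=> //.
have -> : (f (f z)).1 - (f (f w)).1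
    = (z.1 - w.1) * 3 - ((f z).1 - (f w).1) * ((f z).1 + (f w).1).
  by rewrite /henon_fun /=; ring.
apply: padic_normB_le; first by apply: padic_normM_le; rewrite ?norm3.
rewrite -[leRHS]mulr1; apply: padic_normM_le => //.
by apply: padic_normD_le; exact: norm_near1_le1.
Qed.

Lemma disc01_iter2 k z : disc01 z -> disc01 (iter k.*2 f z).
Proof.
by move=> zA; elim: k => // k IHk; exact/henon_disc10/henon_disc01.
Qed.

Lemma mdist_disc01 z w : disc01 z -> disc01 w -> mdist z w <= 1.
Proof.
move=> [z1 z2] [w1 w2]; rewrite padic_mdist_le.
apply/andP; split; apply: padic_normB_le.
- exact: norm_le1 z1.
- exact: norm_le1 w1.
- exact: norm_near1_le1 z2.
- exact: norm_near1_le1 w2.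
Qed.

Lemma henon_iter2_contract k z w : disc01 z -> disc01 w ->
  mdist (iter k.*2 f z) (iter k.*2 f w) <= 3^-1 ^+ k.
Proof.
move=> zA wA; elim: k => [|k IHk]; first exact: mdist_disc01.
by rewrite exprSr; apply: henon2_contract IHk; exact: disc01_iter2.
Qed.

(** A cycle exchanging [(x, y)] and [(y, x)] has [x ^+ 2 = a + 2 * y] and [y ^+ 2 = a + 2 * x]. For
    [x != y], subtracting gives [x + y = - 2]; then [x = s - 1] leads to [s ^+ 2 = a - 3]. The root
    near 1 puts the point in [disc01]. *)
Lemma henon_fixed2 : exists z, disc01 z /\ f (f z) = z.
Proof.
have [//||s s2 s1] := @padic_sqrt R 3 isT (a - 3).
  have -> : a - 3 - 1 = a - 1 - 3 * 1 by ring.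
  by apply: padic_normB_le => //; apply: norm3M; rewrite padic_norm1.
exists (s - 1, - s - 1); split.
  split=> //=; have -> : - s - 1 - 1 = - (s - 1) - 3 * 1 by ring.
  apply: padic_normB_le; first by rewrite padic_normN.
  by apply: norm3M; rewrite padic_norm1.
have aE : a = s ^+ 2 + 3 by rewrite s2 subrK.
by rewrite /henon_fun /= aE; congr (_, _); ring.
Qed.

Lemma bounded_orbit_le1 (z : int -> (Q3 R * Q3 R)%type) (C : R) :
  (forall n, z (n + 1) = f (z n)) -> (forall n, padic_norm2 (z n) <= C) ->
  forall n, norm (z n).1 <= 1 /\ norm (z n).2 <= 1.
Proof.
move=> zS zC; have z2E n : (z n).2 = (z (n - 1)).1.
  by rewrite -{1}(subrK 1 n) zS.
suff z1 n : norm (z n).1 <= 1 by move=> n; rewrite z2E.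
have z1C t : norm (z t).1 <= C by have := zC t; rewrite ge_max => /andP[].
rewrite leNgt; apply/negP.
(* At this [m] the squared norm beats 1 and all other norms, contradicting the ultrametric bound on
   [zmE]. *)
move=> /(@lt_sq_sup R int (fun n => norm (z n).1) C n z1C)[m zm].
have zmE : (z m).1 * (z m).1 = a + 3 * (z (m - 1)).1 - (z (m + 1)).1.
  by rewrite -z2E zS /henon_fun /=; ring.
have := zm (m - 1); have := zm (m + 1); rewrite /= !gt_max.
rewrite expr2 -padic_normM zmE => /andP[m1 zp] /andP[_ zp'].
have : norm (a + 3 * (z (m - 1)).1 - (z (m + 1)).1) <=
    Num.max 1 (Num.max (norm (z (m - 1)).1) (norm (z (m + 1)).1)).
  apply: padic_normB_le; last by rewrite !le_max lexx !orbT.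
  apply: padic_normD_le; first by rewrite !le_max a_le1.
  by rewrite !le_max padic_normM norm3 ler_piMl ?padic_norm_ge0 ?orbT.
by rewrite leNgt !gt_max m1 zp zp'.
Qed.

End Dynamics.

(** * The Julia set as a cycle, and its basin *)

Section Attractor.
Context (R : realType) (a : Q3 R).
Hypothesis a1 : padic_norm (a - 1) <= 3^-1.

Local Notation f := (henon_fun a 3).
Local Notation phi := (henon a 3 (padic_natr_neq0 3 isT)).
Local Notation disc01 := (@disc01 R).
Local Notation disc10 := (@disc10 R).
Implicit Types z w P : (Q3 R * Q3 R)%type.

Let third_ge0 : 0 <= 3^-1 :> R. Proof. by rewrite invr_ge0. Qed.

Let third_lt1 : 3^-1 < 1 :> R. Proof. by rewrite invf_lt1 ?ltr1n. Qed.

(** Every orbit point is the image under [f] twice of the point two steps earlier, which lies in the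
    unit polydisc. *)
Lemma julia_disc z : julia_set phi z ->
  forall n, disc01 (iterz phi n z) \/ disc10 (iterz phi n z).
Proof.
move=> [C zC] n; pose zs m := iterz phi m z.
have zS m : zs (m + 1) = f (zs m) by exact: (iterzS phi m z).
have zs1 := bounded_orbit_le1 a1 zS zC.
rewrite -/(zs n) -(subrK 1 n) zS -(subrK 1 (n - 1)) zS.
by have [] := zs1 (n - 1 - 1); exact: (henon2_disc a1).
Qed.

Variable P : (Q3 R * Q3 R)%type.
Hypotheses (P01 : disc01 P) (fP : f (f P) = P).

Let fP10 : disc10 (f P). Proof. exact: henon_disc01. Qed.

Lemma iter2_fixed k : iter k.*2 f P = P.
Proof. by elim: k => // k IHk; rewrite doubleS !iterS IHk. Qed.

(* A bounded orbit stays in the two discs in the past as well, so that z is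
   the image of points of disc01 under arbitrarily high powers of f^2. *)
Lemma julia_disc01 z : julia_set phi z -> disc01 z -> z = P.
Proof.
move=> zJ z01; have zA := julia_disc zJ; pose zs n := iterz phi n z.
have zS n : zs (n + 1) = f (zs n) by exact: (iterzS phi n z).
have zP k n : disc01 (zs n) -> mdist (zs n) P <= 3^-1 ^+ k.
  elim: k n => [|k IHk] n zn; first exact: mdist_disc01.
  have znE : zs n = f (f (zs (n - 1 - 1))) by rewrite -!zS !subrK.
  (* If it were in [disc10], so would be [zs n], as two steps preserve each disc. *)
  have z2 : disc01 (zs (n - 1 - 1)).
    have [//|/(henon_disc10 a1)/(henon_disc01 a1)] := zA (n - 1 - 1).
    by rewrite -[iterz _ _ _]/(zs (n - 1 - 1)) -znE => /(disc01_10 zn).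
  by rewrite znE -fP exprSr; apply: henon2_contract => //; exact: IHk.
apply: mdist_positivity; apply/eqP; rewrite eq_le mdist_ge0 andbT leNgt.
apply/negP => /(exists_expr_lt third_ge0 third_lt1)[k].
by rewrite ltNge (zP k 0 z01).
Qed.

Lemma julia_henon z : julia_set phi z -> julia_set phi (phi z).
Proof.
move=> [C zC]; exists C => n; rewrite -[phi z]/(phi (iterz phi 0 z)).
suff -> : iterz phi n (phi z) = iterz phi (n + 1) z by exact: zC.
rewrite iterzS; case: n => n; rewrite /iterz; first by rewrite -iterSr.
have [fK Kf] := (homeo_funK phi, homeo_invK phi).
by rewrite iterSr fK iterS Kf.
Qed.

Lemma julia_henonE : julia_set phi = [set P; phi P].
Proof.
apply/seteqP; split=> z.
  move=> zJ; have [z01|z10] := julia_disc zJ 0.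
    by left; exact: julia_disc01.
  (* The image of [z] lies in [disc01], hence is [P = phi (phi P)]; injectivity of [phi] then gives
     [z]. *)
  right; apply: (can_inj (homeo_funK phi)).
  rewrite [RHS]fP; apply: julia_disc01; first exact: julia_henon.
  exact: henon_disc10.
move=> zP; exists (Num.max (padic_norm2 P) (padic_norm2 (phi P))) => n.
have {zP}: [set P; phi P] (iterz phi n z).
  apply: iterz_in zP => w [] -> /=.
  - by right.
  - by left.
  - by right; rewrite -{1}fP; exact: (homeo_funK phi).
  - by left; exact: (homeo_funK phi).
by case=> ->; rewrite le_max lexx ?orbT.
Qed.

(** By the ultrametric inequality, a point within 1/3 of a residue disc stays in it. *)
Lemma open_discs : open (disc01 `|` disc10).
Proof.
rewrite openE => z zA; apply/nbhs_ballP.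
exists 3^-1; first by rewrite /= invr_gt0.
move=> w; rewrite ballEmdist /= => /ltW.
rewrite padic_mdist_le => /andP[d1 d2].
have le0 (x y : Q3 R) : padic_norm (x - y) <= 3^-1 ->
    padic_norm x <= 3^-1 -> padic_norm y <= 3^-1.
  by move=> xy x0; rewrite -(subKr x y); exact: padic_normB_le.
have le1 (x y : Q3 R) : padic_norm (x - y) <= 3^-1 ->
    padic_norm (x - 1) <= 3^-1 -> padic_norm (y - 1) <= 3^-1.
  by move=> xy; apply: le0; rewrite opprB addrA subrK.
case: zA => -[z1 z2]; [left|right]; split.
- exact: le0 d1 z1.
- exact: le1 d2 z2.
- exact: le1 d1 z1.
- exact: le0 d2 z2.
Qed.

(** The inclusion is strict since [disc01] contains both [(0, 1)] and [(3, 1)], but only one cycle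
    point. *)
Lemma discs_neq_cycle : [set P; phi P] `<` disc01 `|` disc10.
Proof.
split=> [|sub]; first by move=> z [] ->; [left | right].
have inP z : disc01 z -> z = P.
  move=> z01; have [//|zE] := sub z (or_introl z01).
  by case: (disc01_10 z01); rewrite zE.
have in01 (x : Q3 R) : padic_norm x <= 3^-1 -> disc01 (x, 1).
  by move=> x3; split=> //; rewrite [(_, _).2]/= subrr padic_norm0.
have n0 : padic_norm (0 : Q3 R) <= 3^-1 by rewrite padic_norm0.
have n3 : padic_norm (3 : Q3 R) <= 3^-1 by rewrite (@padic_norm_p R 3 isT).
have : ((3, 1) : Q3 R * Q3 R).1 = ((0, 1) : Q3 R * Q3 R).1.
  by rewrite (inP _ (in01 _ n0)) (inP _ (in01 _ n3)).
by move/eqP; rewrite (negbTE (padic_natr_neq0 3 isT)).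
Qed.

Lemma discs_attracted z : disc01 z \/ disc10 z ->
  inf [set mdist (iter n phi z) w | w in [set P; phi P]]
    @[n --> \oo] --> (0 : R).
Proof.
move=> zA; have iterA n : disc01 (iter n f z) \/ disc10 (iter n f z).
  elim: n => // n [/(henon_disc01 a1)|/(henon_disc10 a1)]; [by right | by left].
apply/cvgrPdist_le => e e0.
have [k ke] := exists_expr_lt third_ge0 third_lt1 e0.
(* The last [k.*2.+1] steps hold [k] contractions and one spare step: taken last when they start in
   [disc01], ending near [phi P], and first when they start in [disc10], ending near [P]. *)
exists k.*2.+1 => // n /= kn.
set D := [set mdist _ w | w in _].
have lbD : lbound D 0 by move=> _ [w _ <-]; exact: mdist_ge0.
have D0 : 0 <= inf D.
  by apply: lb_le_inf => //; exists (mdist (iter n phi z) P), P => //; left.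
rewrite sub0r normrN ger0_norm // (le_trans _ (ltW ke)) //.
suff [w wP] : exists2 w, [set P; phi P] w & mdist (iter n f z) w <= 3^-1 ^+ k.
  by apply: le_trans; apply: ge_inf; [exists 0 | exists w].
have [z01|z10] := iterA (n - k.*2.+1)%N.
  exists (phi P); first by right.
  have -> : iter n f z = f (iter k.*2 f (iter (n - k.*2.+1) f z)).
    by rewrite -iterD -iterS; congr iter; lia.
  have kP := henon_iter2_contract a1 k z01 P01; rewrite (iter2_fixed k) in kP.
  by apply: le_trans kP; apply: henon_nonexpansive => //; exact: disc01_iter2.
exists P; first by left.
have -> : iter n f z = iter k.*2 f (iter (n - k.*2.+1).+1 f z).
  by rewrite -iterD; congr iter; lia.
rewrite -[in X in mdist _ X](iter2_fixed k); apply: henon_iter2_contract => //.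
exact: henon_disc10.
Qed.

End Attractor.

Theorem theorem4p10 (R : realType) (a : Q3 R) :
  padic_norm (a - 1) <= 3^-1 ->
  let phi := henon a 3 (padic_natr_neq0 3 isT) in
  attracting_2cycle phi (julia_set phi).
Proof.
move=> a1 phi; have [P [P01 fP]] := henon_fixed2 a1.
have JE := julia_henonE a1 P01 fP; rewrite JE; split; last first.
  exists P; split=> //; apply/eqP => PE; apply: (disc01_10 P01).
  by rewrite PE; exact: henon_disc01.
split.
- by exists P; left.
- by apply: compactU; exact: compact_set1.
- rewrite image_setU !image_set1 setUC; congr (_ `|` _).
  by congr [set _]; exact: fP.
- exists (@disc01 R `|` @disc10 R); split.
  + exact: open_discs.
  + exact: discs_neq_cycle.
  + by move=> b; exact: discs_attracted.
Qed.
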